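(* Let $k>2$, $sc_k=(k,k-1,\ldots,1)$ and $n=k(k+1)/2$. If $S\in SYT(sc_k)$, then promotion $\partial$ rotates the descent vector $\mathrm{Des}_e(S)$ to the right by one position; that is, for every $i$ (indices taken modulo $2n$), the $(i+1)$-st box of $\mathrm{Des}_e(\partial(S))$ is dotted if and only if the $i$-th box of $\mathrm{Des}_e(S)$ is dotted.
   Context: Tableaux are in English notation; box $(i,j)$ is in row $i$ from the top and column $j$ from the left. $SYT(\lambda)$ is the set of standard Young tableaux of shape $\lambda$. Promotion: for $T\in SYT(\lambda)$ with $|\lambda|=m$, remove the entry $m$ from its box, leaving it empty. Repeatedly move into the empty box the larger of the entries directly north and directly west of it (or the only one present), so the empty box moves to the position of that entry, until the empty box reaches $(1,1)$. Then put $0$ in the empty box and add $1$ to every entry. The result is $\partial(T)\in SYT(\lambda)$. Descents: $i$ is a descent of $T$ if $i+1$ appears in a row strictly south of (below) the row of $i$; $\mathrm{Des}(T)$ is the set of descents. Descent vector of a staircase tableau: for $S\in SYT(sc_k)$, $\mathrm{Des}_e(S)$ is an array of $2n$ boxes. For $1\le i\le n-1$: if $i\in\mathrm{Des}(S)$ the $i$-th box is dotted and the $(n+i)$-th is empty; otherwise the $(n+i)$-th box is dotted and the $i$-th is empty. If $1\in\mathrm{Des}(\partial(S))$ the $n$-th box is empty and the $2n$-th is dotted; otherwise the $n$-th box is dotted and the $2n$-th is empty. The left and right edges of the array are identified, so the array is circular. Rotating to the right by one position means the content of the $i$-th box goes to the $(i+1)$-st box (mod $2n$). *)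

(* Defs.v *)
From mathcomp Require Import all_boot.

Set Implicit Arguments.
Unset Strict Implicit.
Unset Printing Implicit Defensive.

(* Rows and columns are indexed from 0: the pair (i, j) is the box usually    *)
(* written (i + 1, j + 1). A shape is the sequence of its row lengths.        *)
Definition boxes (sh : seq nat) : seq (nat * nat) :=
  [seq (i, j) | i <- iota 0 (size sh), j <- iota 0 (nth 0 sh i)].

(* Only the values on the boxes of the shape under consideration matter.      *)
Definition filling := nat * nat -> nat.

Definition is_SYT (sh : seq nat) (T : filling) : Prop :=
  [/\ perm_eq [seq T b | b <- boxes sh] (iota 1 (sumn sh)),
      forall i j, (i, j) \in boxes sh -> (i, j.+1) \in boxes sh ->
        T (i, j) < T (i, j.+1)
    & forall i j, (i, j) \in boxes sh -> (i.+1, j) \in boxes sh ->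
        T (i, j) < T (i.+1, j)].

(* The default (0, 0) is only reached when v is not an entry of T.            *)
Definition box_of (sh : seq nat) (T : filling) (v : nat) : nat * nat :=
  head (0, 0) [seq b <- boxes sh | T b == v].

(* A state is a filling together with its empty box, whose value is junk.     *)
Definition slide_from (c : nat * nat) (st : filling * (nat * nat)) :
    filling * (nat * nat) :=
  let: (T, h) := st in (fun b => if b == h then T c else T b, c).

Definition slide_step (st : filling * (nat * nat)) : filling * (nat * nat) :=
  let: (T, h) := st in
  match h with
  | (0, 0) => st
  | (i.+1, 0) => slide_from (i, 0) st
  | (0, j.+1) => slide_from (0, j) st
  | (i.+1, j.+1) =>
      if T (i.+1, j) < T (i, j.+1) then slide_from (i, j.+1) st
      else slide_from (i.+1, j) st
  end.

(* Each step moves the empty box by one unit north or west, so from (i, j) it *)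
(* reaches (0, 0) after exactly i + j steps.                                  *)
Definition promotion (sh : seq nat) (T : filling) : filling :=
  let: (i, j) := box_of sh T (sumn sh) in
  let: (T', h) := iter (i + j) slide_step (T, (i, j)) in
  fun b => (if b == h then 0 else T' b).+1.

Definition Des (sh : seq nat) (T : filling) : pred nat :=
  [pred i | [&& 0 < i, i < sumn sh
              & (box_of sh T i).1 < (box_of sh T i.+1).1]].

Definition staircase (k : nat) : seq nat := [seq k - i | i <- iota 0 k].

Definition staircase_size (k : nat) : nat := (k * k.+1) %/ 2.

(* [true] means dotted; p : 'I_(2 * n) stands for the box numbered p + 1.     *)
Definition Des_e (k : nat) (S : filling) :
    {ffun 'I_(2 * staircase_size k) -> bool} :=
  let sc := staircase k in
  let n := staircase_size k in
  [ffun p : 'I_(2 * n) =>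
    let i := p.+1 in
    if i < n then i \in Des sc S
    else if i == n then 1 \notin Des sc (promotion sc S)
    else if i < 2 * n then i - n \notin Des sc S
    else 1 \in Des sc (promotion sc S)].

(* Main.v *)
Require Import Defs.
From mathcomp Require Import all_boot.
From mathcomp Require Import zify.

(** Why the theorem holds. List the boxes of a standard tableau by decreasing
    entry. Removing the largest box leaves a hole h, and the sliding path of
    promotion can be read off in one pass over the rest of the list: when the
    hole meets a box directly north or west of it, the two exchange places;
    otherwise nothing moves ([slide]). This is the right path because, of the
    two neighbours of the hole, the larger entry is met first. So promotion
    turns the list h :: r into slide h r ([presents_promotion]), and questions
    about it become inductions on r in which only two or three consecutive
    boxes of a growing chain of Young diagrams interact.

    Box n + 1 of the new descent vector is governed by the same condition as
    box n of the old one, and box 1 of the new by the same as box 2n of the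
    old. Elsewhere the rotation says two things about a tableau S of size n.

    - For 0 < i < n - 1, i is a descent of S iff i + 1 is one of its promotion.
      Both boxes that hold i and i + 1 move by at most one unit when the hole
      passes, and the comparison of their rows survives ([descent_slide]).

    - n - 1 is a descent of S iff 1 is not a descent of the second promotion.
      Let h1 and h2 be the boxes of n and n - 1 in S. In a staircase they are
      not adjacent ([staircase_corners]), so the first slide leaves n - 1 in
      its box h2, where the second slide starts, and the rows of h1 and h2
      differ. Both slides can be run simultaneously, each entry meeting
      first the first hole and then the second one. The comparison
      of the rows of the two holes never changes on the way
      ([descent_two_slides]). In the end the first hole is at the northwest
      box, which receives 1, and 2 stands where the second hole was, next to
      it, just before its last move. So 2 is in the second row iff h1 is in a
      row north of h2, that is, iff n - 1 is not a descent of S. *)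

(** * Growing chains of Young diagrams *)

(** The guards matter in the first row and column, where the truncated
    predecessor would make b its own neighbour. *)
Definition nw (a b : nat * nat) : bool :=
  (a == (b.1.-1, b.2)) && (0 < b.1) || (a == (b.1, b.2.-1)) && (0 < b.2).

(** A standard tableau as the chain of Young diagrams formed by its entries at
    most v, for v = 0, 1, ...: these are the tails of the list, which starts
    with the box added last. *)
Fixpoint chain (r : seq (nat * nat)) : Prop :=
  if r is b :: r' then
    [/\ b \notin r', forall a, nw a b -> a \in r' & chain r']
  else True.

Lemma nw_north i j : nw (i, j) (i.+1, j).
Proof. by rewrite /nw eqxx. Qed.

Lemma nw_west i j : nw (i, j) (i, j.+1).
Proof. by rewrite /nw eqxx orbT. Qed.

Lemma nwP {a b} : nw a b -> b = (a.1.+1, a.2) \/ b = (a.1, a.2.+1).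
Proof.
case: a b => [i j] [[|i'] [|j']]; rewrite /nw /= ?andbF ?andbT ?orbF //=.
- by move/eqP=> [-> ->]; right.
- by move/eqP=> [-> ->]; left.
by case/orP=> /eqP[-> ->]; [left | right].
Qed.

Lemma nw_rows {a b} : nw a b -> a.1 <= b.1 <= a.1.+1.
Proof. by case/nwP=> ->; rewrite /= leqnn leqnSn. Qed.

Lemma nw_content {a b} : nw a b -> b.1 + b.2 = (a.1 + a.2).+1.
Proof. by case/nwP=> ->; rewrite /= ?addSn ?addnS. Qed.

Lemma chain_uniq r : chain r -> uniq r.
Proof. by elim: r => //= b r IH [-> _ /IH]. Qed.

Lemma chain_ideal {r a b} : chain r -> nw a b -> b \in r -> a \in r.
Proof.
elim: r => //= c r IH [_ Hc Cr] ab; rewrite !inE.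
by case/orP=> [/eqP bc|/(IH Cr ab)->]; rewrite ?orbT // Hc ?orbT -?bc.
Qed.

Lemma chain_row {r i j j'} : chain r -> j <= j' -> (i, j') \in r -> (i, j) \in r.
Proof.
move=> Cr /subnK <-; elim: (j' - j) => // d IH Hd.
exact: IH (chain_ideal Cr (nw_west i (d + j)) Hd).
Qed.

Lemma chain_drop2 {z y r} : chain [:: z, y & r] -> ~~ nw y z -> chain (z :: r).
Proof.
move=> [/norP[_ zr] Hz [_ _ Cr]] Nyz; split=> // a az.
by move: (Hz a az); rewrite inE => /orP[/eqP ay|//]; rewrite -ay az in Nyz.
Qed.

Lemma chain_swap {z y r} :
  chain [:: z, y & r] -> ~~ nw y z -> chain [:: y, z & r].
Proof.
move=> C Nyz; have Cz := chain_drop2 C Nyz; move: C => [].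
rewrite inE negb_or => /andP[zy zr] _ [yr Hy _]; split=> //.
  by rewrite inE negb_or eq_sym zy.
by move=> a /Hy ar; rewrite inE ar orbT.
Qed.

(** In a single row, boxes are added from left to right without gaps, so two
    successive ones are adjacent. *)
Lemma chain_rows_neq {y x r} : chain [:: y, x & r] -> ~~ nw x y -> y.1 != x.1.
Proof.
case: y x => [i j] [i' j'] [yxr Hy [xr Hx Cr]] Nxy; apply/eqP=> /= e.
subst i'; move: yxr; rewrite inE negb_or => /andP[yx yr].
case: (ltngtP j j') => [lt|lt|e]; last by rewrite e eqxx in yx.
- case: j' lt xr Hx {Hy Nxy yx} => // j' lt xr Hx.
  move/negP: yr; apply; rewrite ltnS in lt.
  exact: chain_row Cr lt (Hx _ (nw_west _ _)).
case: j lt yx yr Hy Nxy => // j lt yx yr Hy Nxy.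
have := Hy _ (nw_west _ _); rewrite inE => /orP[/eqP e|jr].
  by rewrite -e nw_west in Nxy.
by move/negP: xr; apply; rewrite ltnS in lt; exact: chain_row Cr lt jr.
Qed.

(** The three boxes cannot form a bend: the fourth box of the 2 by 2 square
    around a bend lies between x and z, so it would have to be added between
    them, where only y is. *)
Lemma chain_straight {z y x r} : chain [:: z, y, x & r] -> nw x y -> nw y z ->
  (x.1 < y.1) = (y.1 < z.1).
Proof.
case: x => i j [_ Hz [_ _ [xr _ Cr]]].
have no_bend c : nw c z -> nw (i, j) c -> c <> y -> c <> (i, j) -> False.
  move=> cz xc cy cx; move/negP: xr; apply; apply: (chain_ideal Cr xc).
  by have := Hz c cz; rewrite !inE => /or3P[/eqP|/eqP|].
case/nwP=> yE /nwP[] zE; subst y z; rewrite /= ?ltnSn ?ltnn //.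
- by case: (no_bend (i, j.+1)); rewrite ?nw_north ?nw_west //; case; lia.
by case: (no_bend (i.+1, j)); rewrite ?nw_north ?nw_west //; case; lia.
Qed.

(** * Descents under one and two slides *)

(** The hole h travels through the boxes r, in decreasing order of their
    entries. The i-th box of the result is where the i-th largest entry ends
    up, and the last one is the final place of the hole. *)
Fixpoint slide (h : nat * nat) (r : seq (nat * nat)) : seq (nat * nat) :=
  if r is b :: r' then
    if nw b h then h :: slide b r' else b :: slide h r'
  else [:: h].

Lemma size_slide h r : size (slide h r) = (size r).+1.
Proof. by elim: r h => //= b r IH h; case: ifP; rewrite /= IH. Qed.

Lemma perm_slide h r : perm_eq (slide h r) (h :: r).
Proof.
elim: r h => //= b r IH h; case: ifP => _; first by rewrite perm_cons.
apply: (@perm_trans _ [:: b, h & r]); first by rewrite perm_cons.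
by rewrite (perm_catCA [:: b] [:: h]).
Qed.

(** An exchange leaves h as the last box added, with b as the hole below it in
    the chain. Without one, b and h are not adjacent, so they may be added to r
    in the other order. *)
Lemma chain_slide h r : chain (h :: r) -> chain (slide h r).
Proof.
elim: r h => //= b r IH h C; case: ifP => bh.
  case: C => hbr Hh Cb; split; last exact: IH.
    by rewrite (perm_mem (perm_slide _ _)).
  by move=> a /Hh; rewrite (perm_mem (perm_slide _ _)).
have Cs : chain [:: b, h & r] by apply: chain_swap C _; rewrite bh.
case: Cs => bhr Hb Ch; split; last exact: IH.
  by rewrite (perm_mem (perm_slide _ _)).
by move=> a /Hb; rewrite (perm_mem (perm_slide _ _)).
Qed.

(** Entries decrease along the list, so positions i.+1 and i hold consecutive
    entries v and v.+1, and this says that v is a descent. *)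
Definition descent_at (r : seq (nat * nat)) (i : nat) : bool :=
  (nth (0, 0) r i.+1).1 < (nth (0, 0) r i).1.

(** Only the passage of the hole through two successive boxes x, y matters.
    If both move, the three boxes are collinear. If one moves, by a unit south
    or east, the row comparison could only change through a tie, and ties are
    excluded by [chain_rows_neq], the two boxes in question being
    non-adjacent. *)
Lemma descent_slide h r i : chain (h :: r) -> i.+1 < size r ->
  descent_at (slide h r) i = descent_at r i.
Proof.
elim: r h i => //= x r IH h [|i]; last first.
  move=> C; rewrite ltnS => ir; rewrite {2}/descent_at /=.
  case: ifP => xh; rewrite /descent_at /= -/(descent_at _ _) IH //.
    by case: C.
  by apply: chain_drop2 C _; rewrite xh.
case: r {IH} => //= y r C _; rewrite /descent_at.
case: ifP => xh; case: ifP => yx /=.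
- by rewrite (chain_straight C).
- have := nw_rows xh.
  by case: C => _ _ /chain_rows_neq; rewrite yx => /(_ isT); lia.
- have := chain_rows_neq C; rewrite xh => /(_ isT).
  by have := nw_rows yx; lia.
by [].
Qed.

Lemma chain1 {h} : chain [:: h] -> h = (0, 0).
Proof.
case: h => [[|i] [|j]] [_ H _] //.
- by have := H _ (nw_west _ _).
- by have := H _ (nw_north _ _).
by have := H _ (nw_west _ _).
Qed.

(** The holes h1 and h2 meet each box b in turn, h1 first; where h1 exchanges
    with b, it is its old place that h2 sees. The same analysis as for
    [descent_slide], with two holes and one box in place of one hole and two
    boxes, shows that the order of the rows of the holes is preserved. In the
    end h1 is the northwest box, h2 is adjacent to it and the last exchange
    puts the entry at h1 into h2. *)
Lemma descent_two_slides h2 h1 r : chain [:: h2, h1 & r] ->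
  descent_at (slide h2 (slide h1 r)) (size r) = (h1.1 < h2.1).
Proof.
elim: r h2 h1 => [|b r IH] h2 h1 C /=.
  suff -> : nw h1 h2 by [].
  apply/negPn/negP=> N; have /chain1 h2E := chain_drop2 C N.
  by case: C => h2h1 _ /chain1 h1E; rewrite h1E h2E in h2h1.
have C1 : chain [:: h1, b & r] by case: C.
case: ifP => bh1 /=; case: ifP => h12; rewrite /descent_at /= -/(descent_at _ _).
- by rewrite IH // (chain_straight C).
- have Cs : chain [:: h2, b & r] by apply: chain_drop2 C _; rewrite h12.
  rewrite IH //; have := chain_rows_neq C; rewrite h12 => /(_ isT).
  by have := nw_rows bh1; lia.
- have Cs : chain [:: b, h1 & r] by apply: chain_swap C1 _; rewrite bh1.
  rewrite IH //; have := chain_rows_neq C1; rewrite bh1 => /(_ isT).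
  by have := nw_rows h12; lia.
apply: IH; case: C => h2h1 H2 _; split.
- by apply: contra h2h1; rewrite !inE => /orP[]->; rewrite ?orbT.
- move=> a ah2; move: (H2 a ah2); rewrite !inE => /or3P[->//|/eqP ab|->].
    by rewrite -ab ah2 in h12.
  by rewrite orbT.
by apply: chain_drop2 C1 _; rewrite bh1.
Qed.

(** * Sliding fillings and sliding lists *)

Fixpoint numbered (T : filling) (r : seq (nat * nat)) : Prop :=
  if r is b :: r' then T b = size r /\ numbered T r' else True.

(** The last stage of promotion. *)
Definition finish (st : filling * (nat * nat)) : filling :=
  fun b => (if b == st.2 then 0 else st.1 b).+1.

Lemma promotionE sh T (c := box_of sh T (sumn sh)) :
  promotion sh T = finish (iter (c.1 + c.2) slide_step (T, c)).
Proof.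
by rewrite /c /promotion; case: (box_of _ _ _) => i j /=; case: (iter _ _ _).
Qed.

Lemma eq_numbered T T' r : {in r, T =1 T'} -> numbered T r -> numbered T' r.
Proof.
elim: r => //= b r IH E [<- Hr]; split; first by rewrite E ?mem_head.
by apply: IH Hr => a ar; rewrite E // inE ar orbT.
Qed.

Lemma numbered_le {T r b} : numbered T r -> b \in r -> T b <= size r.
Proof.
elim: r => //= c r IH [Hc Hr]; rewrite inE => /orP[/eqP->|/(IH Hr)]; lia.
Qed.

(** Both neighbours of the hole lie in b :: r, where b has the largest entry,
    so b is the neighbour to be moved whenever it is one. *)
Lemma slide_step_nw {T b h r} : chain [:: h, b & r] -> numbered T (b :: r) ->
  nw b h -> slide_step (T, h) = (fun a => if a == h then T b else T a, b).
Proof.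
move=> [_ Hh _] [Tb Tr] bh.
have le_b a : nw a h -> a != b -> T a < T b.
  move=> /Hh; rewrite inE => /orP[->//|/(numbered_le Tr)].
  by rewrite Tb.
case: h b bh le_b {Hh Tb Tr} => [[|i] [|j]] [x y] /nwP[] //= [] // <- <- le_b //.
  by have /= := le_b _ (nw_west _ _); rewrite xpair_eqE gtn_eqF ?ltnSn // => ->.
have /= := le_b _ (nw_north _ _); rewrite xpair_eqE ltn_eqF ?ltnSn // => /(_ isT) lt.
by rewrite ltnNge ltnW.
Qed.

(** The second part records that nothing outside the diagram h :: r moves; it is
    what determines the final entry of a box once the hole has passed it. *)
Lemma slide_steps {T h r} (st := iter (h.1 + h.2) slide_step (T, h)) :
  chain (h :: r) -> numbered T r ->
  numbered (finish st) (slide h r) /\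
  (forall b, b \notin h :: r -> finish st b = (T b).+1).
Proof.
rewrite {}/st; elim: r T h => [|b r IH] T h C N.
  have -> := chain1 C; rewrite /finish /=; split; first by [].
  by move=> b; rewrite inE => /negbTE ->.
rewrite [slide _ _]/=; case: ifP => bh.
  rewrite (nw_content bh) iterSr (slide_step_nw C N bh).
  case: C N => hbr _ Cb [Tb Tr].
  have [] := IH (fun a => if a == h then T b else T a) b Cb.
    apply: eq_numbered Tr => a ar; case: eqP => // ah.
    by rewrite -ah inE ar orbT in hbr.
  set F := finish _ => NF HF; split.
    by split=> //; rewrite HF // eqxx Tb /= size_slide.
  move=> c; rewrite inE negb_or => /andP[/negbTE ch cbr].
  by rewrite HF // ch.
have Cs : chain [:: b, h & r] by apply: chain_swap C _; rewrite bh.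
have [bhr _ Ch] := Cs; case: N => Tb Tr.
have [NF HF] := IH T h Ch Tr; split.
  by split=> //; rewrite HF // Tb /= size_slide.
by move=> c cbr; apply: HF; apply: contra cbr; rewrite !inE => /orP[]->; rewrite ?orbT.
Qed.

(** * Tableaux presented by lists of boxes *)

Definition presents (sh : seq nat) (T : filling) (r : seq (nat * nat)) : Prop :=
  [/\ chain r, numbered T r & perm_eq r (boxes sh)].

Lemma size_boxes sh : size (boxes sh) = sumn sh.
Proof.
rewrite size_allpairs_dep; congr sumn; rewrite -[RHS](mkseq_nth 0) /mkseq.
by apply: eq_map => i; rewrite size_iota.
Qed.

Lemma mem_boxes sh i j : ((i, j) \in boxes sh) = (j < nth 0 sh i).
Proof.
apply/allpairsPdep/idP => [[x [y [_]]]|lt].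
  by rewrite mem_iota /= => lt [-> ->].
exists i, j; rewrite !mem_iota /= lt; split=> //.
by rewrite ltnNge; apply: contraL lt => le; rewrite nth_default.
Qed.

Lemma filter_numbered {T r i} : numbered T r -> i < size r ->
  [seq b <- r | T b == size r - i] = [:: nth (0, 0) r i].
Proof.
elim: r i => //= b r IH [|i] [Tb Tr] ir; rewrite Tb.
  rewrite subn0 eqxx; congr cons; apply/eqP; rewrite -[_ == _]negbK -has_filter.
  by apply/hasPn=> a /(numbered_le Tr); lia.
by rewrite subSS ifN ?IH //; lia.
Qed.

Lemma box_of_presents {sh T r i} : presents sh T r -> i < sumn sh ->
  box_of sh T (sumn sh - i) = nth (0, 0) r i.
Proof.
case=> _ Tr rsh ish; have szr : size r = sumn sh by rewrite (perm_size rsh) size_boxes.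
rewrite -szr in ish *; rewrite /box_of.
suff -> : [seq b <- boxes sh | T b == size r - i] = [:: nth (0, 0) r i] by [].
apply: perm_small_eq => //.
by rewrite -(filter_numbered Tr ish) perm_filter // perm_sym.
Qed.

Lemma Des_presents {sh T r i} : presents sh T r -> 0 < i < sumn sh ->
  (i \in Des sh T) = descent_at r (sumn sh - i.+1).
Proof.
move=> P /andP[i0 ish]; rewrite inE i0 ish /= /descent_at.
rewrite -!(box_of_presents P); try lia.
have -> : sumn sh - (sumn sh - i.+1).+1 = i by lia.
by have -> : sumn sh - (sumn sh - i.+1) = i.+1 by lia.
Qed.

Lemma presents_promotion {sh T h r} : presents sh T (h :: r) ->
  presents sh (promotion sh T) (slide h r).
Proof.
move=> P; case: (P) => C [_ Tr] rsh.
have n0 : 0 < sumn sh by rewrite -size_boxes -(perm_size rsh).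
have hE : box_of sh T (sumn sh) = h.
  by rewrite -[sumn sh]subn0 (box_of_presents P).
rewrite promotionE hE; split; first exact: chain_slide.
- by have [] := slide_steps C Tr.
exact: perm_trans (perm_slide _ _) rsh.
Qed.

(** The list is built from the smallest entry on: the box of v.+1 goes in front
    of the boxes with entries at most v, its neighbours being among them as
    their entries are smaller. *)
Lemma SYT_presents {sh T} :
  (forall a b, nw a b -> b \in boxes sh -> a \in boxes sh) ->
  is_SYT sh T -> exists r, presents sh T r.
Proof.
move=> ideal [Tsh Trow Tcol].
have Tnw a b : nw a b -> b \in boxes sh -> T a < T b.
  move=> ab bsh; have := ideal _ _ ab bsh; case: a ab => i j ab ash.
  by case/nwP: ab bsh => -> bsh; [apply: Tcol | apply: Trow].
have Tinj : {in boxes sh &, injective T}.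
  move=> a b ash bsh Tab; have := iota_uniq 1 (sumn sh).
  rewrite -(perm_uniq Tsh); case/rot_to: ash => m s sE.
  rewrite -(rot_uniq m) -map_rot sE /= Tab => /andP[/negP Tbs _].
  move: bsh; rewrite -(mem_rot m) sE inE => /orP[/eqP->//|/(map_f T)/Tbs[]].
have Tval b : b \in boxes sh -> 0 < T b.
  by move=> /(map_f T); rewrite (perm_mem Tsh) mem_iota => /andP[].
have Tmax b : b \in boxes sh -> T b <= sumn sh.
  by move=> /(map_f T); rewrite (perm_mem Tsh) mem_iota add1n ltnS => /andP[].
suff [r [Cr Tr _ rE]] : exists r, [/\ chain r, numbered T r, size r = sumn sh
    & forall b, (b \in r) = (b \in boxes sh) && (T b <= sumn sh)].
  exists r; split=> //; apply: uniq_perm; first exact: chain_uniq.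
    by apply: (@map_uniq _ _ T); rewrite (perm_uniq Tsh) iota_uniq.
  by move=> b; rewrite rE andb_idr //; apply: Tmax.
elim: {-2}(sumn sh) (leqnn (sumn sh)) => [_|v IH vsh].
  exists [::]; split=> // b; rewrite in_nil; apply/esym/negP=> /andP[/Tval].
  by lia.
have [r [Cr Tr szr rE]] := IH (ltnW vsh).
have /mapP[b bsh Tb] : v.+1 \in [seq T b | b <- boxes sh].
  by rewrite (perm_mem Tsh) mem_iota add1n ltnS.
exists (b :: r); split=> /=; rewrite ?szr -?Tb //.
  split=> //; first by rewrite rE -Tb ltnn andbF.
  by move=> a ab; rewrite rE (ideal a b) //=; have := Tnw a b ab bsh; lia.
move=> c; rewrite inE rE; case: eqP => [->|cb]; first by rewrite bsh -Tb leqnn.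
case csh: (c \in _) => //=; rewrite [RHS]leq_eqVlt ltnS.
by case: eqP => // e; case: cb; apply: Tinj => //; rewrite e.
Qed.

(** * The staircase *)

Lemma nth_staircase k i : nth 0 (staircase k) i = k - i.
Proof.
case: (ltnP i k) => ik.
  by rewrite (nth_map 0) ?size_iota // nth_iota.
by rewrite nth_default ?size_map ?size_iota //; lia.
Qed.

Lemma mem_staircase k b : (b \in boxes (staircase k)) = (b.1 + b.2 < k).
Proof. by case: b => i j; rewrite mem_boxes nth_staircase /=; lia. Qed.

Lemma staircase_ideal k a b :
  nw a b -> b \in boxes (staircase k) -> a \in boxes (staircase k).
Proof. by move=> /nw_content; rewrite !mem_staircase => -> /ltnW. Qed.

Lemma sumn_staircase k : sumn (staircase k) = staircase_size k.
Proof.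
suff /(congr1 (divn^~ 2)) : 2 * sumn (staircase k) = k * k.+1 by rewrite mulKn.
elim: k => // k IH; suff -> : staircase k.+1 = k.+1 :: staircase k.
  by rewrite /= mulnDr IH; lia.
by rewrite /staircase /= (iotaDl 1 0 k) -map_comp subn0.
Qed.

(** The corners of a staircase form an antidiagonal. If h2 was next to h1, the
    other box c next to h2 on the antidiagonal of h1 would also be in the
    staircase, hence in r, although r does not contain h2. *)
Lemma staircase_corners {k h1 h2 r} : chain [:: h1, h2 & r] ->
  perm_eq [:: h1, h2 & r] (boxes (staircase k)) -> ~~ nw h2 h1.
Proof.
move=> [h12r H1 [h2r H2 Cr]] P; apply/negP=> h21.
have no_bend c : nw h2 c -> c.1 + c.2 = h1.1 + h1.2 -> c <> h1 -> False.
  move=> h2c ch1 c1; have : c \in [:: h1, h2 & r].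
    rewrite (perm_mem P) mem_staircase ch1 -mem_staircase -(perm_mem P).
    exact: mem_head.
  rewrite !inE => /or3P[/eqP//|/eqP ch2|/(chain_ideal Cr h2c)].
    by have := nw_content h2c; rewrite ch2; lia.
  by rewrite (negbTE h2r).
case: h2 h21 no_bend {h12r H1 h2r H2 P} => i j /nwP[] -> no_bend.
- by case: (no_bend _ (nw_west _ _)) => /=; [lia | case; lia].
- by case: (no_bend _ (nw_north _ _)) => /=; [lia | case; lia].
Qed.

Lemma Des_promotion {sh T r i} : presents sh T r -> 0 < i -> i.+1 < sumn sh ->
  (i.+1 \in Des sh (promotion sh T)) = (i \in Des sh T).
Proof.
case: r => [[_ _ /perm_size]|h r P i0 ish]; first by rewrite size_boxes => <-.
rewrite (Des_presents P) 1?(Des_presents (presents_promotion P));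
  try lia.
case: P => C _ /perm_size; rewrite size_boxes /= => szr.
rewrite descent_slide //; last by lia.
by have -> : sumn sh - i.+1 = (sumn sh - i.+2).+1 by lia.
Qed.

(** As h1 and h2 are not adjacent, the slide from h1 leaves h2 at the head of
    the list, and the second slide starts there. *)
Lemma Des_promotion2 {k T r} (n := sumn (staircase k)) :
  presents (staircase k) T r -> 2 < n ->
  (1 \in Des (staircase k) (promotion (staircase k) (promotion (staircase k) T)))
  = (n.-1 \notin Des (staircase k) T).
Proof.
move=> P n2; have : size r = n.
  by case: P => _ _ /perm_size ->; rewrite size_boxes.
case: r P => [|h1 [|h2 r]] P szr; rewrite /= in szr; try lia.
have [C _ Psh] := P.
have N := staircase_corners C Psh.
have P1 := presents_promotion P; rewrite /= (negbTE N) in P1.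
have P2 := presents_promotion P1.
(* In slide h2 (slide h1 r), of size (size r).+2, the entries 1 and 2 are in the
   last two positions. *)
rewrite (Des_presents P2) ?(Des_presents P); try (rewrite -/n; lia).
have -> : sumn (staircase k) - 2 = size r by rewrite -/n; lia.
have -> : sumn (staircase k) - n.-1.+1 = 0 by rewrite -/n; lia.
rewrite descent_two_slides; last exact: chain_swap C N.
by rewrite /descent_at /= -leqNgt ltn_neqAle (chain_rows_neq C N).
Qed.

Theorem theorem4p12 (k : nat) (hk : 2 < k) (S : filling)
    (hS : is_SYT (staircase k) S) (i : 'I_(2 * staircase_size k)) :
  Des_e k (promotion (staircase k) S) (ordS i) = Des_e k S i.
Proof.
have [r P] := SYT_presents (staircase_ideal k) hS.
have n2 : 2 < sumn (staircase k).
  rewrite sumn_staircase leq_divRL //.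
  by apply: (@leq_trans (3 * 4)) => //; apply: leq_mul.
have shift j := @Des_promotion _ _ _ j P.
have top := Des_promotion2 P n2.
rewrite !sumn_staircase in n2 shift top.
rewrite !ffunE /=; set n := staircase_size k in n2 shift top i *.
(* The index p stands for the box numbered p.+1, so the cases are split according
   to p.+1 and to the number p.+2 of the next box. *)
case: i => p /= pn.
have [->|pn'] := eqVneq p.+1 (2 * n).
  have -> : 2 * n < n = false by lia.
  have -> : 2 * n == n = false by lia.
  by rewrite modnn ltnn (ltnW n2).
rewrite modn_small; last by lia.
have [lt|[e|gt]] : p.+2 < n \/ p.+2 = n \/ n < p.+2 by lia.
- by rewrite lt ltnW // shift.
- by rewrite e ltnn eqxx top negbK -e /= ltnSn.
have [e|gt1] : p.+1 = n \/ n < p.+1 by lia.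
  rewrite e ltnn eqxx.
  have -> : n.+1 < n = false by lia.
  have -> : n.+1 == n = false by lia.
  have -> : n.+1 < 2 * n by lia.
  by rewrite subSnn.
have -> : p.+2 < n = false by lia.
have -> : p.+2 == n = false by lia.
have -> : p.+1 < n = false by lia.
have -> : p.+1 == n = false by lia.
have -> : p.+1 < 2 * n by lia.
have [e|lt] : p.+2 = 2 * n \/ p.+2 < 2 * n by lia.
  have -> : p.+1 - n = n.-1 by lia.
  by rewrite e ltnn top.
rewrite lt subSn; last by lia.
by rewrite shift //; lia.
Qed.
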